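(* Let $\Gamma$ be a connected unbalanced unicyclic signed graph (with at least one edge) whose Laplacian eigenvalues are $\mu_1\ge\mu_2\ge\cdots\ge\mu_n>0$. Then $S(\Gamma)\times K_2$ and $S(\Gamma)\otimes K_2$ are noncospectral and equienergetic if and only if $\mu_n\ge 1$.
   Context: A signed graph $\Gamma=(G,\sigma)$ is a simple graph $G$ with a sign function $\sigma:E(G)\to\{1,-1\}$; $A(\Gamma)$ has $(i,j)$ entry $\sigma(v_iv_j)$ if $v_iv_j\in E(G)$ and $0$ otherwise, and $L(\Gamma)=D(G)-A(\Gamma)$ with $D(G)$ the diagonal degree matrix. Unbalanced means some cycle has an odd number of negative edges; unicyclic means $G$ is connected with exactly one cycle. The energy $\mathcal{E}(\Gamma)$ is the sum of absolute values of the adjacency eigenvalues; two signed graphs are equienergetic if they have equal energy, and noncospectral if their adjacency spectra differ. Signed subdivision graph $S(\Gamma)$: fix $\vartheta(v,e)\in\{1,-1\}$ for each vertex $v$ incident with edge $e$, with $\vartheta(v,e)\vartheta(w,e)=-\sigma(e)$ for every edge $e=vw$; $S(\Gamma)$ has vertex set $V(G)\cup E(G)$ and an edge $ve$ of sign $\vartheta(v,e)$ whenever $v$ is an end of $e$, and no other edges. $K_2$ denotes the single positive edge. For signed graphs $\Gamma_1=(G_1,\sigma_1)$, $\Gamma_2=(G_2,\sigma_2)$: the Cartesian product $\Gamma_1\times\Gamma_2$ has vertex set $V(G_1)\times V(G_2)$, with $(u_i,v_j)\sim(u_k,v_l)$ of sign $\sigma_1(u_iu_k)$ if $j=l$ and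 $u_iu_k\in E(G_1)$, and of sign $\sigma_2(v_jv_l)$ if $i=k$ and $v_jv_l\in E(G_2)$. The Kronecker product $\Gamma_1\otimes\Gamma_2$ has vertex set $V(G_1)\times V(G_2)$, with $(u_i,v_j)\sim(u_k,v_l)$ iff $u_iu_k\in E(G_1)$ and $v_jv_l\in E(G_2)$, of sign $\sigma_1(u_iu_k)\sigma_2(v_jv_l)$. *)

(* Defs.v *)
(* Signed graphs are encoded by their signed adjacency
   function  sg : T -> T -> int  on a finite vertex type T
   (sg x y = sigma(xy) if xy is an edge, 0 otherwise). *)
From HB Require Import structures.
From mathcomp Require Import all_boot all_order all_algebra all_field.
Set Implicit Arguments. Unset Strict Implicit. Unset Printing Implicit Defensive.
Import Order.TTheory GRing.Theory Num.Theory.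
Local Open Scope ring_scope.

Section SignedGraphs.
Variable T : finType.
Implicit Types (sg : T -> T -> int).

Definition signed_graph sg : Prop :=
  forall x y, sg x y = sg y x /\ sg x x = 0 /\ sg x y \in [:: -1; 0; 1].

Definition adjr sg : rel T := fun x y => sg x y != 0.

Definition connected_sg sg : Prop := forall x y, connect (adjr sg) x y.

Definition is_cycle sg (s : seq T) : bool :=
  [&& (2 < size s)%N, uniq s & cycle (adjr sg) s].

(* connected with exactly one cycle (cycles identified up to
   rotation and reversal of their vertex sequence) *)
Definition unicyclic sg : Prop :=
  connected_sg sg /\ (exists s, is_cycle sg s) /\
  forall s t, is_cycle sg s -> is_cycle sg t ->
    exists k, t = rot k s \/ t = rot k (rev s).

Definition cycle_sign sg (s : seq T) : int := \prod_(x <- s) sg x (next s x).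

Definition unbalanced sg : Prop :=
  exists s, is_cycle sg s /\ cycle_sign sg s = -1.

Definition adjmx sg : 'M[int]_#|T| :=
  \matrix_(i, j) sg (enum_val i) (enum_val j).

Definition degree sg (x : T) : nat := #|[set y | adjr sg x y]|.

Definition lapmx sg : 'M[int]_#|T| :=
  \matrix_(i, j) ((i == j)%:R * (degree sg (enum_val i))%:R
                  - sg (enum_val i) (enum_val j)).

(* spectrum (eigenvalues with multiplicity) of an integer matrix, computed
   as the roots of its characteristic polynomial in the algebraic closure
   algC of Q (in which the complex/real eigenvalues live) *)
Definition mx_spectrum n (M : 'M[int]_n) : seq algC :=
  sval (closed_field_poly_normal (char_poly (map_mx (fun z : int => z%:~R) M))).

Definition spectrum sg : seq algC := mx_spectrum (adjmx sg).
Definition lap_spectrum sg : seq algC := mx_spectrum (lapmx sg).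

Definition energy sg : algC := \sum_(r <- spectrum sg) `|r|.

(* edges of G, each listed once (ordered by enum_rank) *)
Definition edge sg := {p : T * T | (enum_rank p.1 < enum_rank p.2)%N && adjr sg p.1 p.2}.

Definition incident sg (v : T) (e : edge sg) : bool :=
  (v == (val e).1) || (v == (val e).2).

Definition subdiv_signs sg (th : T -> edge sg -> int) : Prop :=
  forall e : edge sg,
    [/\ th (val e).1 e \in [:: -1; 1], th (val e).2 e \in [:: -1; 1]
      & th (val e).1 e * th (val e).2 e = - sg (val e).1 (val e).2].

End SignedGraphs.

Definition subdiv (T : finType) (sg : T -> T -> int) (th : T -> edge sg -> int)
  (a b : T + edge sg) : int :=
  match a, b with
  | inl v, inr e => if incident v e then th v e else 0
  | inr e, inl v => if incident v e then th v e else 0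
  | _, _ => 0
  end.

Definition K2 (a b : bool) : int := (a != b)%:R.

Definition cart_prod (T1 T2 : finType) (s1 : T1 -> T1 -> int) (s2 : T2 -> T2 -> int)
  (p q : T1 * T2) : int :=
  (if p.2 == q.2 then s1 p.1 q.1 else 0) + (if p.1 == q.1 then s2 p.2 q.2 else 0).

Definition kron_prod (T1 T2 : finType) (s1 : T1 -> T1 -> int) (s2 : T2 -> T2 -> int)
  (p q : T1 * T2) : int := s1 p.1 q.1 * s2 p.2 q.2.

Definition cospectral (T1 T2 : finType) (s1 : T1 -> T1 -> int) (s2 : T2 -> T2 -> int) : Prop :=
  perm_eq (spectrum s1) (spectrum s2).

Definition equienergetic (T1 T2 : finType) (s1 : T1 -> T1 -> int) (s2 : T2 -> T2 -> int) : Prop :=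
  energy s1 = energy s2.

(* Main.v *)
Require Import Defs.
From HB Require Import structures.
From mathcomp Require Import all_boot all_order perm all_algebra all_field.
From mathcomp Require Import ring.
Set Implicit Arguments. Unset Strict Implicit. Unset Printing Implicit Defensive.
Import Order.TTheory GRing.Theory Num.Theory.
Local Open Scope ring_scope.

(* If z runs over the spectrum of a signed graph S on N vertices, the Cartesian
   product of S with K2 has the eigenvalues z + 1 and z - 1, and the Kronecker
   product has z and -z.  The sums of squares of these two families differ by
   2N, so the products are never cospectral; and |z + 1| + |z - 1| >= 2|z| with
   equality exactly when |z| >= 1 (z is real), so they are equienergetic iff
   every |z| >= 1.
   For a subdivision, the signed incidence matrix B satisfies B B^T = L.
   Deleting an edge of the unique cycle leaves a forest, so there are at most as
   many edges as vertices, while unbalance and connectedness make the left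
   kernel of B trivial; hence B is square and invertible, and the Laplacian
   eigenvalues are exactly the squares of those of the subdivision. *)

(** * Characteristic polynomials under reindexing, block symmetry, shift and negation *)

(** Rows and columns undergo the same permutation, so its sign enters squared. The sizes [n] and [m]
    are kept apart because the cardinal of a product type is not convertible to a sum of
    cardinals. *)
Lemma det_mxsub_bij (R : comNzRingType) n m (f : 'I_n -> 'I_m) (M : 'M[R]_m) :
  bijective f -> \det (mxsub f f M) = \det M.
Proof.
move=> bijf; have eq_nm : n = m.
  by have := bij_eq_card bijf; rewrite !card_ord.
case: m / eq_nm f M bijf => f M bijf.
have injf := bij_inj bijf.
have -> : mxsub f f M = row_perm (perm injf) (col_perm (perm injf) M).
  by apply/matrixP=> i j; rewrite !mxE !permE.
rewrite row_permE col_permE !det_mulmx !det_perm odd_permV.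
by rewrite mulrCA -expr2 sqrr_sign mulr1.
Qed.

Lemma char_poly_mxsub_bij (R : comNzRingType) n m (f : 'I_n -> 'I_m)
    (M : 'M[R]_m) : bijective f -> char_poly (mxsub f f M) = char_poly M.
Proof.
move=> bijf; rewrite /char_poly -(det_mxsub_bij _ bijf); congr (\det _).
by apply/matrixP=> i j; rewrite !mxE (inj_eq (bij_inj bijf)).
Qed.

(** Adding the second block row to the first, then subtracting the first block column from the
    second, leaves a block lower triangular matrix. *)
Lemma det_block_sym (R : comNzRingType) n (P Q : 'M[R]_n) :
  \det (block_mx P Q Q P) = \det (P + Q) * \det (P - Q).
Proof.
rewrite -[RHS](det_lblock (P + Q) Q (P - Q)).
have -> : block_mx (P + Q) 0 Q (P - Q) =
    block_mx 1%:M 1%:M 0 1%:M *m block_mx P Q Q P *m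
    block_mx 1%:M (- 1%:M) 0 1%:M.
  rewrite !mulmx_block !mul1mx !mul0mx !mulmx1 !mulmx0 !add0r !addr0.
  by rewrite !mulmxN !mulmx1 (addrC Q P) addNr (addrC (- Q)).
by rewrite !det_mulmx !det_ublock !det1 !mulr1 !mul1r.
Qed.

Lemma char_poly_block_sym (R : comNzRingType) n (P Q : 'M[R]_n) :
  char_poly (block_mx P Q Q P) = char_poly (P + Q) * char_poly (P - Q).
Proof.
rewrite /char_poly.
have -> : char_poly_mx (block_mx P Q Q P) =
    block_mx (char_poly_mx P) (- map_mx polyC Q) (- map_mx polyC Q)
             (char_poly_mx P).
  rewrite /char_poly_mx map_block_mx (scalar_mx_block n n).
  by rewrite opp_block_mx add_block_mx !add0r.
rewrite det_block_sym /char_poly_mx map_mxD map_mxB.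
by rewrite !opprD !opprK !addrA.
Qed.

Lemma char_poly_addC (R : comNzRingType) n (A : 'M[R]_n) c :
  char_poly (A + c%:M) = char_poly A \Po ('X - c%:P).
Proof.
rewrite /char_poly -det_map_mx; congr (\det _).
apply/matrixP=> i j; rewrite !mxE.
case: (i == j); rewrite ?mulr1n ?mulr0n /= rmorphB /= comp_polyC ?rmorph0.
  by rewrite comp_polyX polyCD opprD addrA addrAC.
by rewrite addr0 comp_polyC.
Qed.

Lemma char_poly_opp (R : comNzRingType) n (A : 'M[R]_n) :
  char_poly (- A) = (-1) ^+ n * (char_poly A \Po (- 'X)).
Proof.
rewrite /char_poly -det_map_mx -detZ; congr (\det _).
apply/matrixP=> i j; rewrite !mxE mulN1r.
case: (i == j); rewrite ?mulr1n ?mulr0n rmorphB /= comp_polyC polyCN ?rmorph0.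
  by rewrite comp_polyX opprB !opprK addrC.
by rewrite comp_polyC !sub0r.
Qed.

Section Split.
Variables (R : comNzRingType) (n : nat) (A : 'M[R]_n) (s : seq R).
Hypothesis charA : char_poly A = \prod_(z <- s) ('X - z%:P).

Lemma char_poly_addC_split c :
  char_poly (A + c%:M) = \prod_(z <- [seq z + c | z <- s]) ('X - z%:P).
Proof.
rewrite char_poly_addC charA rmorph_prod big_map; apply: eq_bigr => z _ /=.
by rewrite rmorphB /= comp_polyX comp_polyC polyCD opprD addrA addrAC.
Qed.

Lemma size_char_poly_split : size s = n.
Proof. by have := size_char_poly A; rewrite charA size_prod_XsubC => -[]. Qed.

Lemma char_poly_opp_split :
  char_poly (- A) = \prod_(z <- [seq - z | z <- s]) ('X - z%:P).
Proof.
(* There are exactly [n] roots, so the factor [(-1) ^+ n] supplies one sign to each linear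
   factor. *)
rewrite char_poly_opp charA rmorph_prod big_map -size_char_poly_split.
elim: (s) => [|z r IHr]; first by rewrite !big_nil mulr1.
rewrite !big_cons -IHr /= exprS rmorphB /= comp_polyX comp_polyC.
rewrite mulrACA polyCN; congr (_ * _).
by rewrite mulN1r opprB !opprK addrC.
Qed.
End Split.

(** * Spectra of the two products with [K2] *)

Definition algC_mx (T : finType) (F : T -> T -> int) : 'M[algC]_#|T| :=
  \matrix_(i, j) (F (enum_val i) (enum_val j))%:~R.

Lemma algC_mx_adjmx (T : finType) (F : T -> T -> int) :
  algC_mx F = map_mx (fun z : int => z%:~R) (adjmx F).
Proof. by apply/matrixP=> i j; rewrite !mxE. Qed.

Lemma spectrum_split (T : finType) (F : T -> T -> int) :
  char_poly (algC_mx F) = \prod_(z <- spectrum F) ('X - z%:P).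
Proof.
rewrite algC_mx_adjmx /spectrum /mx_spectrum.
case: closed_field_poly_normal => r /= {1}->.
by rewrite (monicP (char_poly_monic _)) scale1r.
Qed.

(** A factorization into monic linear factors is unique up to order, so exhibiting one determines
    the spectrum. *)
Lemma perm_spectrum (T : finType) (F : T -> T -> int) s :
  char_poly (algC_mx F) = \prod_(z <- s) ('X - z%:P) -> perm_eq (spectrum F) s.
Proof. by rewrite spectrum_split; apply: prod_XsubC_eq. Qed.

Section DoubleCover.
Variables (T : finType).

(** Lists the layer [true] before the layer [false], which puts the matrix of a graph on two copies
    of [T] in 2 by 2 block form. *)
Definition pair_index (i : 'I_(#|T| + #|T|)) : 'I_#|{: T * bool}| :=
  enum_rank (match split i with
             | inl j => (enum_val j, true)
             | inr j => (enum_val j, false)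
             end).

Lemma pair_index_bij : bijective pair_index.
Proof.
apply: inj_card_bij; last first.
  by rewrite !card_ord card_prod card_bool muln2 addnn.
move=> i j /enum_rank_inj.
case: splitP => i' Ei; case: splitP => j' Ej // -[/enum_val_inj eq_ij];
  by apply: val_inj; rewrite /= Ei Ej eq_ij.
Qed.

Lemma char_poly_pair (F : T * bool -> T * bool -> int) (P Q : 'M[algC]_#|T|) :
  (forall i j b c, (F (enum_val i, b) (enum_val j, c))%:~R
                   = if b == c then P i j else Q i j) ->
  char_poly (algC_mx F) = char_poly (P + Q) * char_poly (P - Q).
Proof.
move=> FE; rewrite -(char_poly_mxsub_bij _ pair_index_bij).
rewrite -char_poly_block_sym; congr char_poly.
apply/matrixP=> i j; rewrite !mxE !enum_rankK.
by case: splitP => i' _; rewrite mxE; case: splitP => j' _; rewrite FE.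
Qed.

Lemma spectrum_cart_K2 (F : T -> T -> int) :
  perm_eq (spectrum (cart_prod F K2))
    ([seq z + 1 | z <- spectrum F] ++ [seq z - 1 | z <- spectrum F]).
Proof.
apply: perm_spectrum; rewrite big_cat /=.
rewrite -!(char_poly_addC_split (spectrum_split F)) rmorphN /=.
(* Within a layer the block is the matrix of [F]; across layers it is the identity. *)
apply: char_poly_pair => i j b c; rewrite !mxE /cart_prod /K2 /=.
by rewrite (inj_eq enum_val_inj); case: eqP => _; case: eqP; rewrite ?addr0 ?add0r.
Qed.

Lemma spectrum_kron_K2 (F : T -> T -> int) :
  perm_eq (spectrum (kron_prod F K2))
    (spectrum F ++ [seq - z | z <- spectrum F]).
Proof.
apply: perm_spectrum; rewrite big_cat /= -spectrum_split.
rewrite -(char_poly_opp_split (spectrum_split F)).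
(* Here all edges cross between the layers, so the diagonal blocks vanish. *)
rewrite (@char_poly_pair _ 0 (algC_mx F)) ?add0r // => i j b c; rewrite !mxE /kron_prod /K2 /=.
by case: eqP; rewrite ?mulr0 ?mulr1.
Qed.
End DoubleCover.

Lemma cart_kron_K2_noncospectral (T : finType) (F : T -> T -> int) :
  (0 < #|T|)%N -> ~ cospectral (cart_prod F K2) (kron_prod F K2).
Proof.
move=> T_gt0; rewrite /cospectral.
rewrite (permPl (spectrum_cart_K2 F)) (permPr (spectrum_kron_K2 F)) => eq_sp.
have := perm_big (op := +%R) (x := 0) (P := xpredT) (F := fun z => z ^+ 2) _ eq_sp.
rewrite !big_cat !big_map /= -!big_split /= => /eqP.
rewrite -subr_eq0 -sumrB.
(* Each eigenvalue contributes exactly 2 to the difference of the sums of squares. *)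
rewrite (eq_bigr (fun=> 2)) => [|z _]; last by ring.
rewrite big_const_seq count_predT (size_char_poly_split (spectrum_split F)).
by rewrite iter_addr_0 mulrn_eq0 pnatr_eq0 -leqn0 leqNgt T_gt0.
Qed.

(** * Eigenvectors, reality of the spectrum, and comparison of energies *)

(** Replaces row vectors over ordinals by functions on vertices; the vector stands on the left, as
    in [eigenvalue]. *)
Lemma mem_spectrum (T : finType) (F : T -> T -> int) z :
  z \in spectrum F <->
  exists2 v : T -> algC, exists x, v x != 0 &
    forall y, \sum_x v x * (F x y)%:~R = z * v y.
Proof.
rewrite -root_prod_XsubC -spectrum_split -eigenvalue_root_char.
split=> [/eigenvalueP[v /rowP vF v_neq0] | [v [x vx_neq0] vF]].
  exists (fun x => v 0 (enum_rank x)).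
    have /rV0Pn[i vi] := v_neq0.
    by exists (enum_val i); rewrite enum_valK.
  move=> y; have := vF (enum_rank y); rewrite !mxE => <-.
  rewrite (reindex_onto enum_val enum_rank) => [|i _]; last exact: enum_rankK.
  apply: eq_big => [i|i _]; first by rewrite enum_valK eqxx.
  by rewrite !mxE enum_valK enum_rankK.
apply/eigenvalueP; exists (\row_i v (enum_val i)).
  apply/rowP=> j; rewrite !mxE -vF; apply: esym.
  rewrite (reindex_onto enum_val enum_rank) => [|i _]; last exact: enum_rankK.
  apply: eq_big => [i|i _]; first by rewrite enum_valK eqxx.
  by rewrite !mxE.
by apply/rV0Pn; exists (enum_rank x); rewrite mxE enum_rankK.
Qed.

(** With [N] the squared norm of an eigenvector, [z * N] is the value of a Hermitian form, hence
    self-conjugate, and [N] is real and positive. *)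
Lemma symmetric_spectrum_real (T : finType) (F : T -> T -> int) z :
  (forall x y, F x y = F y x) -> z \in spectrum F -> z \is Num.real.
Proof.
move=> symF /mem_spectrum[v [x vx] vF].
pose N := \sum_y v y * (v y)^*.
have N_gt0 : 0 < N.
  rewrite /N (bigD1 x) //= ltr_wpDr ?sumr_ge0 // => [y _|].
    exact: mul_conjC_ge0.
  by rewrite mul_conjC_gt0.
have Q_eq : z * N = \sum_x \sum_y v x * (F x y)%:~R * (v y)^*.
  rewrite exchange_big /N mulr_sumr; apply: eq_bigr => y _ /=.
  by rewrite mulrA -vF mulr_suml.
have N_real : N^* = N by rewrite conj_Creal // gtr0_real.
rewrite CrealE; apply/eqP/(mulIf (lt0r_neq0 N_gt0)).
rewrite -{1}N_real -rmorphM Q_eq rmorph_sum exchange_big /=.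
apply: eq_bigr => a _; rewrite rmorph_sum; apply: eq_bigr => b _ /=.
by rewrite !rmorphM /= conjCK rmorph_int symF mulrC mulrA mulrAC.
Qed.

Lemma real_norm_ge1P (z : algC) : z \is Num.real ->
  (`|z + 1| + `|z - 1| - (`|z| + `|- z|) == 0) = (1 <= `|z|).
Proof.
have N1R : (-1 : algC) \is Num.real by rewrite realN real1.
move=> zR; rewrite normrN.
have [z_ge1|z_lt1] := real_leP (real1 _) zR.
  have z_ge0 := le_trans ler01 z_ge1.
  rewrite (ger0_norm z_ge0) z_ge1 !ger0_norm ?subr_ge0 ?addr_ge0 //.
  by apply/eqP; ring.
have [z_leN1|z_gtN1] := real_leP zR N1R.
  have z_le0 : z <= 0 by apply: le_trans z_leN1 _; rewrite lerN10.
  rewrite (ler0_norm z_le0) lerNr z_leN1.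
  rewrite (@ler0_norm _ (z + 1)); last by rewrite -(opprK 1) subr_le0.
  by apply/eqP; ring.
(* Strictly between -1 and 1 the difference equals [2 * (1 - |z|)], which is positive. *)
have ltz : `|z| < 1 by rewrite real_ltr_norml // z_gtN1.
rewrite (real_leNgt (real1 _) (normr_real _)) ltz /=.
rewrite (@ger0_norm _ (z + 1)); last by rewrite -(opprK 1) subr_ge0 ltW.
have -> : z + 1 + (1 - z) - (`|z| + `|z|) = (1 - `|z|) * 2 by ring.
by rewrite mulf_eq0 subr_eq0 pnatr_eq0 orbF gt_eqF.
Qed.

(** The energy difference is a sum over the spectrum of terms that are nonnegative by the triangle
    inequality for [2 z = (z + 1) + (z - 1)]; it vanishes only if every term does. *)
Lemma equienergetic_cart_kron_K2 (T : finType) (F : T -> T -> int) :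
  (forall x y, F x y = F y x) ->
  equienergetic (cart_prod F K2) (kron_prod F K2) <->
  (forall z, z \in spectrum F -> 1 <= `|z|).
Proof.
move=> symF; rewrite /equienergetic /energy.
rewrite (perm_big _ (spectrum_cart_K2 F)) (perm_big _ (spectrum_kron_K2 F)) /=.
rewrite !big_cat !big_map /= -!big_split /=.
have ge0 (z : algC) : true -> 0 <= `|z + 1| + `|z - 1| - (`|z| + `|- z|).
  rewrite subr_ge0 normrN -mulr2n -normrMn.
  have -> : z *+ 2 = (z + 1) + (z - 1) by ring.
  by rewrite ler_normD.
have realF z := @symmetric_spectrum_real _ _ z symF.
split=> [/eqP|sp_ge1].
  rewrite -subr_eq0 -sumrB psumr_eq0 // => /allP sp0 z z_sp.
  by rewrite -real_norm_ge1P ?realF //; have := sp0 z z_sp.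
apply/eqP; rewrite -subr_eq0 -sumrB psumr_eq0 //; apply/allP=> z z_sp /=.
by rewrite real_norm_ge1P ?realF ?sp_ge1.
Qed.

(** * Edge count of a forest *)

Section Forest.
Variables (T : finType) (e : rel T).
Hypotheses (e_sym : symmetric e) (e_irr : irreflexive e).

(* The first vertex of a longest path in A has all its neighbours on the path. *)
Lemma min_degree2_cycle (A : {set T}) :
  A != set0 ->
  (forall x, x \in A -> (1 < #|[set y in A | e x y]|)%N) ->
  exists s, [&& (2 < size s)%N, uniq s & cycle e s].
Proof.
move=> /set0Pn[x0 Ax0] deg2.
pose P k := [exists t : k.-tuple T, [&& uniq t, sorted e t & all [in A] t]].
have exP : exists k, P k.
  by exists 1%N; apply/existsP; exists [tuple x0]; rewrite /= Ax0.
have leP k : P k -> (k <= #|T|)%N.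
  case/existsP=> t /and3P[Ut _ _]; rewrite -(size_tuple t).
  by rewrite -(card_uniqP Ut) max_card.
case: (ex_maxnP exP leP) => k /existsP[[s /= /eqP size_s]] /and3P[Us path_s As] maxk.
have [x [p Es]] : exists x p, s = x :: p.
  have: P 1%N by apply/existsP; exists [tuple x0]; rewrite /= Ax0.
  by move/maxk; rewrite -size_s; case: (s) => // x p; exists x, p.
subst s; move: Us path_s As => /= /andP[xp Up] path_p /andP[Ax Ap].
have nbr_in y : y \in A -> e x y -> y \in p.
  move=> Ay exy; apply/negPn/negP=> yp.
  have: P k.+1.
    have size_yxp : size [:: y, x & p] == k.+1 by rewrite /= -size_s.
    apply/existsP; exists (Tuple size_yxp).
    rewrite /= inE negb_or yp xp Up e_sym exy path_p Ay Ax Ap !andbT.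
    by apply: contraTneq exy => ->; rewrite e_irr.
  by move/maxk; rewrite ltnn.
(* A neighbour other than the successor of [x] on the path gives a chord that closes a cycle. *)
have [y [Ay exy y_head]] : exists y, [/\ y \in A, e x y & y != head x p].
  have := deg2 x Ax; rewrite (cardsD1 (head x p)).
  case: (set_0Vmem ([set y in A | e x y] :\ head x p)) => [-> | [y]].
    by rewrite cards0 addn0; case: (_ \in _).
  by rewrite !inE => /and3P[? ? ?] _; exists y.
have yp := nbr_in y Ay exy.
case/splitPr: yp Up path_p xp y_head => p1 p2.
rewrite -cat_rcons cat_uniq cat_path mem_cat negb_or => /and3P[Up1 _ _].
case/andP=> path_p1 _ /andP[xp1 _] y_head.
exists (x :: rcons p1 y); apply/and3P; split; last 2 first.
- by rewrite /= xp1.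
- by rewrite /cycle rcons_path path_p1 last_rcons e_sym.
(* As [y] is not the head of the path, [p1] is nonempty and the cycle has at least three
   vertices. *)
by case: p1 y_head {Up1 path_p1 xp1} => [|a p1] /=; rewrite ?eqxx // size_rcons.
Qed.

Definition edges_in (A : {set T}) : {set T * T} :=
  [set p | [&& p.1 \in A, p.2 \in A, (enum_rank p.1 < enum_rank p.2)%N
            & e p.1 p.2]].

Hypothesis acyclic : forall s, ~~ [&& (2 < size s)%N, uniq s & cycle e s].

(** Induction on the size of [A]: acyclicity provides a vertex with at most one neighbour in [A],
    and deleting it removes at most one edge. *)
Lemma acyclic_card_edges (A : {set T}) : (#|edges_in A| <= #|A|.-1)%N.
Proof.
have [k leAk] := ubnP #|A|; elim: k A leAk => // k IHk A leAk.
have [->|A_neq0] := eqVneq A set0.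
  by rewrite cards0 leqn0 cards_eq0; apply/eqP/setP=> p; rewrite !inE.
have [x Ax deg1] : exists2 x, x \in A & (#|[set y in A | e x y]| <= 1)%N.
  apply/exists_inP; apply: contraT => /exists_inPn deg2.
  have [|s s_cyc] := min_degree2_cycle A_neq0.
    by move=> x /deg2; rewrite -ltnNge.
  by have := acyclic s; rewrite s_cyc.
have /card_le1_eqP uniq_nbr := deg1.
pose I := [set p in edges_in A | (p.1 == x) || (p.2 == x)].
have I_le1 : (#|I| <= 1)%N.
  apply/card_le1_eqP=> -[a b] [c d]; rewrite !inE /=.
  case/andP=> /and4P[Aa Ab lt_ab eab] ab_x /andP[/and4P[Ac Ad lt_cd ecd]] cd_x.
  (* Two edges at [x] have the same other end; if [x] is the first end of one and the second end of
     the other, the rank order is contradicted. *)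
  have same y z : y \in A -> z \in A -> e x y -> e x z -> y = z.
    by move=> Ay Az exy exz; apply: uniq_nbr; rewrite inE ?Ay ?Az.
  case/orP: ab_x => /eqP Ex; case/orP: cd_x => /eqP Ex';
    rewrite Ex {Ex} in Aa Ab lt_ab eab *; rewrite Ex' {Ex'} in Ac Ad lt_cd ecd *.
  - by rewrite (same b d).
  - rewrite e_sym in ecd; rewrite (same c b) // in lt_cd.
    by rewrite ltnNge (ltnW lt_ab) in lt_cd.
  - rewrite e_sym in eab; rewrite (same d a) // in lt_cd.
    by rewrite ltnNge (ltnW lt_ab) in lt_cd.
  - by rewrite e_sym in eab; rewrite e_sym in ecd; rewrite (same a c).
have sub : edges_in A \subset edges_in (A :\ x) :|: I.
  apply/subsetP=> p; rewrite !inE; case/and4P=> -> -> -> ->.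
  by case: (p.1 == x); case: (p.2 == x).
(* A singleton is treated apart: [.-1] truncates, so induction through the empty set would only give
   the bound 1 instead of 0. *)
have [A1|A_gt1] := leqP #|A| 1.
  have A1' : #|A| = 1%N by apply/eqP; rewrite eqn_leq A1 card_gt0.
  rewrite A1' leqn0 cards_eq0; apply/eqP/setP=> p; rewrite !inE.
  apply/negP=> /and4P[A1p A2p lt_p _].
  have /card_le1_eqP/(_ _ _ A1p A2p) eq12 := A1.
  by rewrite eq12 ltnn in lt_p.
apply: leq_trans (subset_leq_card sub) _.
apply: leq_trans (leq_card_setU _ _) _.
have cardAx : #|A| = #|A :\ x|.+1 by rewrite (cardsD1 x A) Ax.
have := IHk (A :\ x); rewrite cardAx in leAk A_gt1 *.
move=> /(_ leAk) le_IH; rewrite -[#|A :\ x|](prednK A_gt1) -addn1.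
by rewrite leq_add.
Qed.
End Forest.

(** * Edges of a unicyclic graph and the signed incidence matrix *)

Section SignedGraph.
Variables (T : finType) (sg : T -> T -> int).
Hypothesis sgP : signed_graph sg.

Lemma adjr_sym : symmetric (adjr sg).
Proof. by move=> x y; rewrite /adjr (sgP x y).1. Qed.

Lemma adjr_irr : irreflexive (adjr sg).
Proof. by move=> x; rewrite /adjr (sgP x x).2.1 eqxx. Qed.

Lemma adjr_sg_sqr x y : adjr sg x y -> sg x y * sg x y = 1.
Proof.
by rewrite /adjr; have [_ [_]] := sgP x y; rewrite !inE => /or3P[] /eqP->.
Qed.

(** Delete the edge from [a] to its successor on the cycle. A surviving cycle would be a rotation or
    reversal of [s], hence would use the deleted edge; so a forest remains, and the deleted edge
    adds one. *)
Lemma unicyclic_card_edge : unicyclic sg -> (#|{: edge sg}| <= #|T|)%N.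
Proof.
case=> _ [[s s_cyc] uniq_cyc].
have /and3P[size_s Us cyc_s] := s_cyc.
have [a sa] : exists a, a \in s.
  by case: (s) size_s => // a s' _; exists a; rewrite mem_head.
pose b := next s a.
pose e' : rel T := fun u v =>
  adjr sg u v && ~~ (((u, v) == (a, b)) || ((u, v) == (b, a))).
have e'_sym : symmetric e'.
  move=> u v; rewrite /e' adjr_sym !xpair_eqE; congr (_ && ~~ _).
  by rewrite orbC ![(v == _) && _]andbC.
have e'_irr : irreflexive e' by move=> u; rewrite /e' adjr_irr.
have acyc t : ~~ [&& (2 < size t)%N, uniq t & cycle e' t].
  apply/negP=> /and3P[size_t Ut cyc_t].
  have t_cyc : is_cycle sg t.
    rewrite /is_cycle size_t Ut /=.
    by apply: sub_cycle cyc_t => u v /andP[].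
  (* A rotation traverses the deleted edge from [a] to [b], a reversal from [b] to [a]. *)
  have [k [Es|Es]] := uniq_cyc t s t_cyc s_cyc.
    have ta : a \in t by rewrite -(mem_rot k) -Es.
    have := next_cycle cyc_t ta.
    by rewrite -(next_rot k Ut) -Es /e' -/b eqxx andbF.
  have ta : a \in t by rewrite -mem_rev -(mem_rot k) -Es.
  have := prev_cycle cyc_t ta.
  rewrite -(next_rev Ut) -(next_rot k) ?rev_uniq // -Es /e' -/b eqxx.
  by rewrite orbT andbF.
pose p0 := if (enum_rank a < enum_rank b)%N then (a, b) else (b, a).
rewrite card_sig.
have sub : [pred p : T * T | (enum_rank p.1 < enum_rank p.2)%N
              && adjr sg p.1 p.2] \subset p0 |: edges_in e' setT.
  apply/subsetP=> -[u v]; rewrite !inE /= => /andP[lt_uv euv].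
  rewrite /e' euv lt_uv /p0 /=.
  case: (eqVneq (u, v) (a, b)) => [[<- <-]|_]; first by rewrite lt_uv eqxx.
  case: (eqVneq (u, v) (b, a)) => [[<- <-]|_]; last by rewrite orbT.
  by rewrite ltnNge (ltnW lt_uv) eqxx.
apply: leq_trans (subset_leq_card sub) _.
apply: leq_trans (leq_card_setU _ _) _; rewrite cards1.
have := acyclic_card_edges e'_sym e'_irr acyc setT.
rewrite cardsT => le1; apply: leq_trans (_ : 1 + #|T|.-1 <= _)%N.
  by rewrite leq_add2l.
by rewrite add1n prednK //; apply/card_gt0P; exists a.
Qed.

Lemma edge_ends_adj (e : edge sg) : adjr sg (val e).1 (val e).2.
Proof. by case: e => p /= /andP[]. Qed.

Lemma edge_ends_neq (e : edge sg) : (val e).1 != (val e).2.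
Proof. by apply: contraTneq (edge_ends_adj e) => ->; rewrite adjr_irr. Qed.

Lemma adj_edge x y : adjr sg x y ->
  exists e : edge sg, val e = (x, y) \/ val e = (y, x).
Proof.
move=> xy; have [lt|gt|eq] := ltngtP (enum_rank x) (enum_rank y).
- have P : (enum_rank (x, y).1 < enum_rank (x, y).2)%N && adjr sg (x, y).1 (x, y).2.
    by rewrite lt xy.
  by exists (exist _ (x, y) P); left.
- have P : (enum_rank (y, x).1 < enum_rank (y, x).2)%N && adjr sg (y, x).1 (y, x).2.
    by rewrite gt adjr_sym xy.
  by exists (exist _ (y, x) P); right.
by move/val_inj/enum_rank_inj: eq xy => ->; rewrite adjr_irr.
Qed.

(** The two ends fix the edge because the rank order excludes the reversed pair. *)
Lemma edge_determined x y (e f : edge sg) : x != y ->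
  incident x e -> incident y e -> incident x f -> incident y f -> e = f.
Proof.
case: e f => [[a b] /= ab] [[c d] /= cd]; rewrite /incident /= => xy.
have [lab _] := andP ab; have [lcd _] := andP cd; simpl in lab, lcd.
move/eqP in xy; move=> xe ye xf yf; apply: val_inj => /=.
case/orP: xe => /eqP E1; case/orP: ye => /eqP E2;
  case/orP: xf => /eqP E3; case/orP: yf => /eqP E4; try congruence.
all: by rewrite -E3 -E4 E1 E2 ltnNge (ltnW lab) in lcd.
Qed.

Variable th : T -> edge sg -> int.
Hypothesis thP : subdiv_signs th.

(** Entries of the matrix B, the vertex-edge block of the adjacency matrix of the subdivision. *)
Definition incidence v e : int := if incident v e then th v e else 0.

Lemma inc_sqr v e : incidence v e * incidence v e = (incident v e)%:R.
Proof.
rewrite /incidence; case: ifP => [|//].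
have [t1 t2 _] := thP e.
by case/orP=> /eqP->; [move: t1 | move: t2]; rewrite !inE => /orP[]/eqP->.
Qed.

Lemma inc_mul v w e : v != w -> incident v e -> incident w e ->
  incidence v e * incidence w e = - sg v w.
Proof.
move=> vw ve we; rewrite /incidence ve we.
have [_ _ te] := thP e; move: ve we; rewrite /incident.
case/orP=> /eqP Ev /orP[]/eqP Ew; rewrite Ev Ew ?eqxx // in vw *.
by rewrite mulrC te (sgP _ _).1.
Qed.

(** Treats the Laplacian as a weighted graph with loops, so that the lemmas on [spectrum] apply to
    it. *)
Definition lap_entry x y : int := (x == y)%:R * (degree sg x)%:R - sg x y.

Lemma lap_spectrumE : lap_spectrum sg = spectrum lap_entry.
Proof.
rewrite /lap_spectrum /spectrum; congr mx_spectrum.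
by apply/matrixP=> i j; rewrite !mxE /lap_entry (inj_eq enum_val_inj).
Qed.

Definition opposite_end v (e : edge sg) : T :=
  if v == (val e).1 then (val e).2 else (val e).1.

(** Sending an edge at [v] to its other end is a bijection onto the neighbours of [v]. *)
Lemma card_incident v : #|[set e : edge sg | incident v e]| = degree sg v.
Proof.
have oppP e : incident v e ->
    [/\ v != opposite_end v e, incident (opposite_end v e) e
      & adjr sg v (opposite_end v e)].
  have := edge_ends_neq e; have := edge_ends_adj e.
  rewrite /incident /opposite_end => adj_e neq_e.
  have [->|_ /= /eqP->] := eqVneq v (val e).1; first by rewrite eqxx orbT.
  by rewrite eqxx eq_sym neq_e adjr_sym.
rewrite -(@card_in_imset _ _ (opposite_end v)) => [|e f]; last first.
  rewrite !inE => ve vf eq_opp.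
  have [n_e i_e _] := oppP e ve; have [_ i_f _] := oppP f vf.
  by apply: edge_determined n_e ve i_e vf _; rewrite eq_opp.
apply: eq_card => y; rewrite inE.
apply/imsetP/idP => [[e]|vy]; first by rewrite inE => /oppP[_ _ ?] ->.
have neq_vy : v != y by apply: contraTneq vy => ->; rewrite adjr_irr.
have [e Ee] := adj_edge vy; exists e; rewrite ?inE /incident /opposite_end.
  by case: Ee => ->; rewrite eqxx ?orbT.
by case: Ee => -> /=; rewrite ?eqxx // (negPf neq_vy).
Qed.

(** This is B B^T = L: on the diagonal each incident edge contributes 1, and off it at most one edge
    meets both vertices. *)
Lemma inc_gram v w : \sum_e incidence v e * incidence w e = lap_entry v w.
Proof.
rewrite /lap_entry; have [<-|vw] := eqVneq v w.
  rewrite mul1r (sgP v v).2.1 subr0 -card_incident.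
  rewrite -(sum1_card (mem [set e : edge sg | incident v e])) natr_sum.
  rewrite [RHS]big_mkcond; apply: eq_bigr => e _.
  by rewrite inc_sqr inE; case: ifP.
rewrite mul0r sub0r.
have [e /andP[ve we]|none] :=
  pickP [pred e : edge sg | incident v e && incident w e].
  rewrite (bigD1 e) //= inc_mul // big1 ?addr0 // => f fe.
  rewrite /incidence; case: ifP => vf; last by rewrite mul0r.
  case: ifP => wf; last by rewrite mulr0.
  by rewrite (edge_determined vw vf wf ve we) eqxx in fe.
rewrite big1 => [|e _]; last first.
  rewrite /incidence; case: ifP => vf; last by rewrite mul0r.
  case: ifP => wf; last by rewrite mulr0.
  by have := none e; rewrite /= vf wf.
apply/esym/eqP; rewrite oppr_eq0; apply: contraT => /adj_edge[e Ee].
by have := none e; rewrite /= /incident; case: Ee => ->; rewrite !eqxx ?orbT.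
Qed.

(* A left kernel vector satisfies [x v = sg v w * x w] along edges; multiplying
   these equations around an unbalanced cycle forces it to vanish there. *)
Lemma inc_left_inj (x : T -> algC) : connected_sg sg -> unbalanced sg ->
  (forall e, \sum_v x v * (incidence v e)%:~R = 0) -> forall v, x v = 0.
Proof.
move=> conn [s [/and3P[size_s Us cyc_s] sign_s]] xB.
have x_edge (e : edge sg) : x (val e).1 = (sg (val e).1 (val e).2)%:~R * x (val e).2.
  have := xB e; rewrite (bigD1 (val e).1) //= (bigD1 (val e).2) /=; last first.
    by rewrite eq_sym edge_ends_neq.
  rewrite big1 ?addr0 => [|v /andP[v1 v2]]; last first.
    by rewrite /incidence /incident (negPf v1) (negPf v2) mulr0.
  have i1 : incident (val e).1 e by rewrite /incident eqxx.
  have i2 : incident (val e).2 e by rewrite /incident eqxx orbT.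
  rewrite -[sg _ _]opprK -(inc_mul (edge_ends_neq e) i1 i2) => /eqP.
  rewrite addr_eq0 => /eqP/(congr1 (fun z => z * (incidence (val e).1 e)%:~R)).
  rewrite -mulrA -intrM inc_sqr i1 mulr1 => ->.
  by rewrite rmorphN /= intrM; ring.
have x_adj u v : adjr sg u v -> x u = (sg u v)%:~R * x v.
  move=> uv; have [e [Ee|Ee]] := adj_edge uv; have := x_edge e; rewrite Ee //=.
  by move=> ->; rewrite mulrA -intrM (sgP v u).1 adjr_sg_sqr // mul1r.
(* Zeros propagate along edges, so by connectedness a single zero suffices. *)
have x_conn u v : x u = 0 -> x v = 0.
  move=> xu; case/connectP: (conn u v) => p.
  elim: p u xu => [|w p IHp] u xu /=; first by move=> _ ->.
  case/andP=> uw; apply: IHp.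
  by rewrite (@x_adj w u) 1?adjr_sym // xu mulr0.
(* The successor map permutes the vertices of the cycle. *)
have prod_next : \prod_(v <- s) x (next s v) = \prod_(v <- s) x v.
  rewrite -(big_map (next s) xpredT x); apply: perm_big; apply: uniq_perm => //.
    by rewrite map_inj_uniq //; exact: can_inj (prev_next Us).
  move=> v; apply/mapP/idP => [[w ws ->]|vs]; first by rewrite mem_next.
  by exists (prev s v); rewrite ?mem_prev // next_prev.
have : \prod_(v <- s) x v = - \prod_(v <- s) x v.
  rewrite -{2}prod_next -mulN1r -[-1]/((-1)%:~R) -sign_s /cycle_sign.
  rewrite rmorph_prod -big_split /= big_seq [RHS]big_seq.
  by apply: eq_bigr => v vs; apply: x_adj; exact: next_cycle cyc_s vs.
move/eqP; rewrite -addr_eq0 -mulr2n mulrn_eq0 /= prodf_seq_eq0.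
by case/hasP=> u _ /eqP xu v; apply: x_conn xu.
Qed.

(** The trivial left kernel gives B rank [#|T|], which is at least the number of edges; hence the
    columns are independent too. *)
Lemma inc_right_inj (y : edge sg -> algC) : unicyclic sg -> unbalanced sg ->
  (forall v, \sum_e y e * (incidence v e)%:~R = 0) -> forall e, y e = 0.
Proof.
move=> uni unbal By.
pose B : 'M[algC]_(#|T|, #|{: edge sg}|) :=
  \matrix_(i, j) (incidence (enum_val i) (enum_val j))%:~R.
have freeB : row_free B.
  apply: inj_row_free => u /rowP uB; apply/rowP=> i; rewrite mxE.
  rewrite -(enum_valK i).
  apply: (inc_left_inj (x := fun v => u 0 (enum_rank v)) uni.1 unbal) => e.
  have := uB (enum_rank e); rewrite !mxE => uBe; rewrite -[RHS]uBe.
  rewrite (reindex_onto enum_val enum_rank) => [|j _]; last exact: enum_rankK.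
  apply: eq_big => [j|j _]; first by rewrite enum_valK eqxx.
  by rewrite !mxE enum_valK enum_rankK.
have freeBT : row_free B^T.
  rewrite /row_free mxrank_tr eqn_leq rank_leq_col (eqP freeB).
  exact: unicyclic_card_edge.
have: \row_(j < #|{: edge sg}|) y (enum_val j) = 0.
  apply: (row_free_inj freeBT); rewrite /= mul0mx.
  apply/rowP=> i; rewrite !mxE -[RHS](By (enum_val i)); apply: esym.
  rewrite (reindex_onto enum_val enum_rank) => [|j _]; last exact: enum_rankK.
  apply: eq_big => [j|j _]; first by rewrite enum_valK eqxx.
  by rewrite !mxE.
by move=> /rowP y0 e; have := y0 (enum_rank e); rewrite !mxE enum_rankK.
Qed.

(** * Spectrum of the subdivision against the Laplacian spectrum *)

Lemma subdiv_sym a b : subdiv th a b = subdiv th b a.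
Proof. by case: a b => [v|e] [w|f]. Qed.

(* Eigenvectors of the subdivision are pairs (x, y) with x B = z y and
   y B^T = z x, where B is the matrix of [incidence]. *)
Lemma mem_spectrum_subdiv z : z \in spectrum (subdiv th) <->
  exists x : T -> algC, exists y : edge sg -> algC,
  [/\ (exists v, x v != 0) \/ (exists e, y e != 0),
      forall e, \sum_v x v * (incidence v e)%:~R = z * y e
    & forall v, \sum_e y e * (incidence v e)%:~R = z * x v].
Proof.
rewrite mem_spectrum; split=> [[u [a ua] uS]|[x [y [nz xB yB]]]].
  exists (u \o inl), (u \o inr); split.
  - by case: a ua => [v|e]; [left; exists v | right; exists e].
  - move=> e; rewrite -uS big_sumType /= [X in _ + X]big1 ?addr0 //.
    by move=> f _; rewrite mulr0.
  move=> v; rewrite -uS big_sumType /= [X in X + _]big1 ?add0r // => w _.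
  by rewrite mulr0.
exists (fun a => match a with inl v => x v | inr e => y e end).
  by case: nz => [[v]|[e]]; [exists (inl v) | exists (inr e)].
case=> [v|e]; rewrite big_sumType /=.
  by rewrite big1 => [|w _]; [rewrite add0r -yB | rewrite mulr0].
by rewrite [X in _ + X]big1 => [|w _]; [rewrite addr0 -xB | rewrite mulr0].
Qed.

Lemma sum_inc_gram (x : T -> algC) w :
  \sum_e (\sum_v x v * (incidence v e)%:~R) * (incidence w e)%:~R
  = \sum_v x v * (lap_entry v w)%:~R.
Proof.
under eq_bigr do rewrite mulr_suml.
rewrite exchange_big; apply: eq_bigr => v _ /=.
rewrite -inc_gram rmorph_sum mulr_sumr; apply: eq_bigr => e _.
by rewrite -mulrA -intrM.
Qed.

Hypotheses (uni : unicyclic sg) (unbal : unbalanced sg).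

(** At [z = 0] the eigenvector equations decouple into x B = 0 and y B^T = 0, and both kernels are
    trivial. *)
Lemma subdiv_spectrum_neq0 z : z \in spectrum (subdiv th) -> z != 0.
Proof.
case/mem_spectrum_subdiv=> x [y [nz xB yB]]; apply/eqP=> z0.
case: nz => -[i /eqP]; apply.
  by apply: inc_left_inj => // [|e]; [exact: uni.1 | rewrite xB z0 mul0r].
by apply: inc_right_inj => // v; rewrite yB z0 mul0r.
Qed.

(** The vertex part satisfies x L = x B B^T = z y B^T = z^2 x; it is nonzero, since x = 0 would
    force z y = 0 and then y = 0. *)
Lemma subdiv_lap_spectrum z :
  z \in spectrum (subdiv th) -> z ^+ 2 \in lap_spectrum sg.
Proof.
move=> z_sp; have z_neq0 := subdiv_spectrum_neq0 z_sp.
move: z_sp => /mem_spectrum_subdiv[x [y [nz xB yB]]].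
rewrite lap_spectrumE; apply/mem_spectrum; exists x.
  case: nz => [//|[e ye]]; apply/existsP; apply: contraNT ye => /existsPn x0.
  have := xB e; rewrite big1 => [/esym/eqP|v _].
    by rewrite mulf_eq0 (negPf z_neq0).
  by have := x0 v; rewrite negbK => /eqP->; rewrite mul0r.
move=> w; rewrite -sum_inc_gram expr2 -mulrA -yB mulr_sumr.
by apply: eq_bigr => e _; rewrite xB mulrA.
Qed.

(** With z a square root of [mu], an eigenvector x of L extends by y = z^-1 x B. The division is
    legitimate because x B B^T = 0 would give x B = 0 and then x = 0. *)
Lemma lap_subdiv_spectrum mu : mu \in lap_spectrum sg ->
  exists2 z, z \in spectrum (subdiv th) & mu = z ^+ 2.
Proof.
rewrite lap_spectrumE => /mem_spectrum[x [v xv] xL].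
have mu_neq0 : mu != 0.
  apply: contraNneq xv => mu0; apply/eqP.
  apply: inc_left_inj => // [|e]; first exact: uni.1.
  apply: (@inc_right_inj (fun e => \sum_v x v * (incidence v e)%:~R)) => // w.
  by rewrite sum_inc_gram xL mu0 mul0r.
exists (sqrtC mu); last by rewrite sqrtCK.
have z_neq0 : sqrtC mu != 0 by rewrite sqrtC_eq0.
apply/mem_spectrum_subdiv; exists x.
exists (fun e => (sqrtC mu)^-1 * \sum_v x v * (incidence v e)%:~R); split.
- by left; exists v.
- by move=> e; rewrite mulrA divff // mul1r.
move=> w; under eq_bigr do rewrite -mulrA.
rewrite -mulr_sumr sum_inc_gram xL -{2}(sqrtCK mu) expr2.
by rewrite !mulrA mulVf // mul1r.
Qed.

End SignedGraph.

Theorem theorem4p10 (T : finType) (sg : T -> T -> int) (th : T -> edge sg -> int) :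
  signed_graph sg -> unicyclic sg -> unbalanced sg -> subdiv_signs th ->
  (~ cospectral (cart_prod (subdiv th) K2) (kron_prod (subdiv th) K2) /\
   equienergetic (cart_prod (subdiv th) K2) (kron_prod (subdiv th) K2))
  <-> (forall mu, mu \in lap_spectrum sg -> 1 <= mu).
Proof.
move=> sgP uni unbal thP.
(* Noncospectrality holds whatever the Laplacian eigenvalues are; the cycle supplies a vertex. *)
have noncosp : ~ cospectral (cart_prod (subdiv th) K2) (kron_prod (subdiv th) K2).
  apply: cart_kron_K2_noncospectral.
  case: unbal => -[|x s] [/and3P[size_s _ _] _] //.
  by apply/card_gt0P; exists (inl x).
have realS z := @symmetric_spectrum_real _ _ z (subdiv_sym th).
(* For real [z] the square of the norm is [z ^+ 2], which turns the energy criterion into one on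
   Laplacian eigenvalues. *)
have ge1E z : z \in spectrum (subdiv th) -> (1 <= `|z|) = (1 <= z ^+ 2).
  by move=> /realS zR; rewrite -real_normK // expr_ge1.
split=> [[_ /(equienergetic_cart_kron_K2 (subdiv_sym th)) sp_ge1] mu | lap_ge1].
  move=> /(lap_subdiv_spectrum sgP thP uni unbal)[z z_sp ->].
  by rewrite -ge1E ?sp_ge1.
split=> //; apply/(equienergetic_cart_kron_K2 (subdiv_sym th)) => z z_sp.
by rewrite ge1E ?lap_ge1 ?(subdiv_lap_spectrum sgP thP).
Qed.
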